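(* Let $C\subset[0,1]$ be the middle-third Cantor set, let $U\subset\mathbb{R}^2$ be an open set, and let $f:U\to\mathbb{R}$ be a continuous function whose partial derivatives $\partial_x f$ and $\partial_y f$ exist and are continuous on $U$. Suppose there is a point $(x_0,y_0)\in (C\times C)\cap U$ such that $$1<\left|\frac{\partial_x f(x_0,y_0)}{\partial_y f(x_0,y_0)}\right|<3\quad\text{or}\quad 1<\left|\frac{\partial_y f(x_0,y_0)}{\partial_x f(x_0,y_0)}\right|<3 .$$ Then the set $f_U(C,C)=\{f(x,y):(x,y)\in (C\times C)\cap U\}\subset\mathbb{R}$ has non-empty interior in $\mathbb{R}$.
   Context: The middle-third Cantor set $C$ is the unique non-empty compact subset of $\mathbb{R}$ satisfying $C=f_1(C)\cup f_2(C)$, where $f_1(x)=\frac{x}{3}$ and $f_2(x)=\frac{x+2}{3}$. In the hypothesis on the quotients, the denominator in question is understood to be non-zero. *)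

(* Defs.v *)
From HB Require Import structures.
From mathcomp Require Import all_boot all_order all_algebra.
From mathcomp Require Import all_classical all_reals all_analysis.
From mathcomp Require Import ring lra.
Set Implicit Arguments. Unset Strict Implicit. Unset Printing Implicit Defensive.
Import Order.TTheory GRing.Theory Num.Theory.
Import numFieldNormedType.Exports.
Local Open Scope classical_set_scope.
Local Open Scope ring_scope.

Section Cantor.
Context {R : realType}.
Implicit Types A B C : set R.

Definition cantor_f1 (x : R) : R := x / 3.
Definition cantor_f2 (x : R) : R := (x + 2) / 3.

Definition cantor_eq C : Prop :=
  [/\ C !=set0, compact C & C = (cantor_f1 @` C) `|` (cantor_f2 @` C)].

Lemma cantor_eq_ex01 : exists2 C, cantor_eq C & C `<=` `[0, 1].
Proof.
pose F C := (cantor_f1 @` C) `|` (cantor_f2 @` C).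
have Fmono A B : A `<=` B -> F A `<=` F B.
  by move=> AB x [[y Ay <-]|[y Ay <-]]; [left|right]; exists y => //; exact: AB.
pose I : set R := `[0, 1]%classic.
have FI : F I `<=` I.
  by move=> x [[y /= + <-]|[y /= + <-]];
    rewrite /I/= !in_itv/= /cantor_f1 /cantor_f2 => /andP[? ?]; apply/andP; split; lra.
have cf1 : continuous cantor_f1 by move=> x; apply: cvgM; [exact: cvg_id|exact: cvg_cst].
have cf2 : continuous cantor_f2.
  move=> x; apply: cvgM; last exact: cvg_cst.
  by apply: cvgD; [exact: cvg_id|exact: cvg_cst].
have Fcpt A : compact A -> compact (F A).
  by move=> cA; apply: compactU; apply: continuous_compact => //;
    exact: continuous_subspaceT.
pose K : set R := [set x | exists A, [/\ A `<=` I, A `<=` F A & A x]].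
have KI : K `<=` I by move=> x [A [AI _ /AI]].
have KFK : K `<=` F K.
  move=> x [A [AI AF Ax]]; apply: (Fmono A); last exact: AF.
  by move=> y Ay; exists A.
have cI : closed I by exact: interval_closed.
have clI : closure K `<=` I by rewrite [X in _ `<=` X](closure_id I).1//; exact: closureS.
have ccl : compact (closure K).
  by apply: (subclosed_compact _ (@segment_compact R 0 1)) => //; exact: closed_closure.
have clK : closure K `<=` K.
  move=> x clx; exists (closure K); split => //.
  have cF : closed (F (closure K)).
    by apply: compact_closed; [exact: Rhausdorff|exact: Fcpt].
  rewrite [X in _ `<=` X](closure_id _).1//; apply: closureS.
  by apply: (subset_trans KFK); apply: Fmono; exact: subset_closure.
have KE : closure K = K by apply/seteqP; split => //; exact: subset_closure.
exists K => //; split.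
- exists 0, [set 0]; split => // x ->.
  + by rewrite /I/= in_itv/=; apply/andP; split; lra.
  + by left; exists 0 => //; rewrite /cantor_f1 mul0r.
- by rewrite -KE.
- apply/seteqP; split => // x Fx; exists (F K); split => //.
  + by apply: subset_trans FI; exact: Fmono.
  + exact: Fmono.
Qed.

Lemma cantor_eq_ex : exists C, cantor_eq C.
Proof. by have [C hC _] := cantor_eq_ex01; exists C. Qed.

Lemma cantor_eq_sub A B : cantor_eq A -> cantor_eq B -> A `<=` B.
Proof.
move=> [_ cA AE] [[b0 Bb0] cB BE].
have [M0 [_ MA]] := compact_bounded cA.
have {}MA x : A x -> `|x| <= `|M0| + 1.
  by apply: MA; rewrite (le_lt_trans (ler_norm _))// ltrDl.
pose M := `|M0| + 1 + `|b0|.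
have key n : forall a, A a -> exists2 b, B b & `|a - b| <= M / 3 ^+ n.
  elim: n => [|n IH] a Aa.
    exists b0 => //; rewrite expr0 divr1 (le_trans (ler_normB _ _))// lerD2r.
    exact: MA.
  have d (x y : R) : `|x - y| <= M / 3 ^+ n ->  `|(x - y) / 3| <= M / 3 ^+ n.+1.
    move=> h; rewrite normrM exprSr invfM mulrA [`|3^-1|]ger0_norm ?invr_ge0//.
    by rewrite ler_pM2r// invr_gt0.
  move: (Aa); rewrite AE => -[[a' /IH[b Bb ab] <-]|[a' /IH[b Bb ab] <-]].
  - exists (cantor_f1 b); first by rewrite BE; left; exists b.
    by rewrite /cantor_f1 -mulrBl; exact: d.
  - exists (cantor_f2 b); first by rewrite BE; right; exists b.
    by rewrite /cantor_f2 -mulrBl opprD addrACA subrr addr0; exact: d.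
have clB : closed B by apply: compact_closed => //; exact: Rhausdorff.
move=> a Aa; rewrite (closure_id B).1//.
move=> N /nbhs_ballP[e /= e0 eN].
have cvM : M / 3 ^+ n @[n --> \oo] --> (0 : R).
  rewrite -(mulr0 M); apply: cvgM; first exact: cvg_cst.
  under eq_fun do rewrite -exprVn.
  by apply: cvg_expr; rewrite ger0_norm ?invr_ge0// invf_lt1 ?ltr1n.
have /cvgrPdist_lt/(_ _ e0)[n _ /(_ n (leqnn n))] := cvM.
rewrite /= sub0r normrN => Me.
have [b Bb ab] := key n a Aa.
exists b; split => //; apply: eN; rewrite -ball_normE/=.
by rewrite (le_lt_trans ab)// (le_lt_trans (ler_norm _)).
Qed.

Definition cantor_set : set R := get cantor_eq.

Lemma cantor_setP C : cantor_eq C <-> C = cantor_set.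
Proof.
have h : cantor_eq cantor_set := getPex cantor_eq_ex.
by split => [hC|->//]; apply/seteqP; split; exact: cantor_eq_sub.
Qed.

Lemma cantor_set01 : cantor_set `<=` `[0, 1].
Proof. by have [C /cantor_setP <-] := cantor_eq_ex01. Qed.

End Cantor.
Arguments cantor_set R : clear implicits.

Section Partial.
Context {R : realType}.
Implicit Types (f : R * R -> R) (p : R * R).

(* Only the values of [f] near [p] matter, so on an open set these are the
   partial derivatives of the restriction of [f] to it. *)
Definition derivable_x f p : Prop := derivable f p (1, 0).
Definition derivable_y f p : Prop := derivable f p (0, 1).
Definition partial_x f p : R := 'D_(1, 0) f p.
Definition partial_y f p : R := 'D_(0, 1) f p.

End Partial.

(* Main.v *)
(* Continuity of the partial derivatives makes f strictly differentiable at p0,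
   i.e. nearly affine, with gradient (a, b), on small squares around p0; the
   symmetries x |-> 1 - x of C and (x, y) |-> (y, x) reduce to 0 < b < a < 3b.
   Let Q be the product of two triadic intervals of the construction of C, of
   the same length, close to p0. The intervals between the values of f at the
   lower left and upper right corners of the four subsquares of Q kept by the
   construction then overlap, and so cover the corresponding interval of Q.
   Iterating, every value t in that interval is a limit of values of f on
   Q `&` (C `*` C), and is attained by compactness. *)
Require Import Defs.
From HB Require Import structures.
From mathcomp Require Import all_boot all_order all_algebra.
From mathcomp Require Import all_classical all_reals all_analysis.
From mathcomp Require Import ring lra.
Set Implicit Arguments. Unset Strict Implicit. Unset Printing Implicit Defensive.
Import Order.TTheory GRing.Theory Num.Theory.
Import numFieldNormedType.Exports.
Local Open Scope classical_set_scope.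
Local Open Scope ring_scope.

Lemma div_pow3_lt {R : realType} (M r : R) : 0 < r -> exists n, M / 3 ^+ n < r.
Proof.
move=> r0.
have cv0 : M / 3 ^+ n @[n --> \oo] --> (0 : R).
  rewrite -(mulr0 M); apply: cvgM; first exact: cvg_cst.
  under eq_fun do rewrite -exprVn.
  by apply: cvg_expr; rewrite ger0_norm ?invr_ge0// invf_lt1 ?ltr1n.
have /cvgrPdist_lt/(_ _ r0)[n _ /(_ n (leqnn n))] := cv0.
rewrite /= sub0r normrN => nr.
by exists n; exact: le_lt_trans (ler_norm _) nr.
Qed.

(** * Symmetry and self-similarity of the Cantor set *)

Section CantorGeometry.
Context {R : realType}.
Local Notation C := (cantor_set R).

Lemma cantor_setE : C = (cantor_f1 @` C) `|` (cantor_f2 @` C).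
Proof. by have /cantor_setP[_ _] : C = C by []. Qed.

Lemma cantor_set_compact : compact C.
Proof. by have /cantor_setP[] : C = C by []. Qed.

Lemma cantor_f1_in x : C x -> C (cantor_f1 x).
Proof. by move=> Cx; rewrite cantor_setE; left; exists x. Qed.

Lemma cantor_f2_in x : C x -> C (cantor_f2 x).
Proof. by move=> Cx; rewrite cantor_setE; right; exists x. Qed.

(** The reflection exchanges [cantor_f1] and [cantor_f2], so the reflected set solves the same
    defining equation and uniqueness identifies it with [C]. *)
Lemma cantor_set_reflect x : C x -> C (1 - x).
Proof.
pose D := [set 1 - x | x in C].
suff /cantor_setP DC : cantor_eq D by move=> Cx; rewrite -DC; exists x.
have [C0 cC CE] : cantor_eq C by exact/cantor_setP.
split.
- by have [c Cc] := C0; exists (1 - c), c.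
- apply: continuous_compact => //; apply: continuous_subspaceT => y.
  by apply: cvgD; [exact: cvg_cst|apply: cvgN; exact: cvg_id].
- apply/seteqP; split => [_ [y + <-]|_ [[_ [y Cy <-] <-]|[_ [y Cy <-] <-]]].
  + rewrite CE => -[[z Cz <-]|[z Cz <-]].
    * by right; exists (1 - z); [exists z|rewrite /cantor_f1 /cantor_f2; field].
    * by left; exists (1 - z); [exists z|rewrite /cantor_f1 /cantor_f2; field].
  + exists (cantor_f2 y); first exact: cantor_f2_in.
    by rewrite /cantor_f1 /cantor_f2; field.
  + exists (cantor_f1 y); first exact: cantor_f1_in.
    by rewrite /cantor_f1 /cantor_f2; field.
Qed.

(* The model case: [ `[u, u + s] ] is a triadic interval of the construction of [C]. *)
Definition cantor_copy (u s : R) := forall c, C c -> C (u + s * c).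

Lemma cantor_copy1 u s : cantor_copy u s -> cantor_copy u (s / 3).
Proof.
move=> us c /cantor_f1_in /us; congr (C _).
by rewrite /cantor_f1; field.
Qed.

Lemma cantor_copy2 u s : cantor_copy u s -> cantor_copy (u + 2 * s / 3) (s / 3).
Proof.
move=> us c /cantor_f2_in /us; congr (C _).
by rewrite /cantor_f2; field.
Qed.

(** The induction passes to a preimage of [x] under one of the two contractions, and maps the
    interval found around that preimage forward by the same contraction. *)
Lemma cantor_copy_around n x : C x ->
  exists u, cantor_copy u (3 ^- n) /\ u <= x <= u + 3 ^- n.
Proof.
elim: n x => [|n IH] x Cx.
  exists 0; split; first by move=> c; rewrite expr0 invr1 mul1r add0r.
  have := cantor_set01 Cx; rewrite /= in_itv/= expr0 invr1 add0r.
  by move=> ->.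
have E : 3 ^- n.+1 = 3 ^- n / 3 :> R by rewrite exprS invfM mulrC.
move: Cx; rewrite cantor_setE => -[[y /IH[u [us yu]] <-]|[y /IH[u [us yu]] <-]].
- exists (cantor_f1 u); split; last by rewrite E /cantor_f1; lra.
  move=> c /us /cantor_f1_in; congr (C _).
  by rewrite E /cantor_f1; field; exact: expf_neq0.
- exists (cantor_f2 u); split; last by rewrite E /cantor_f2; lra.
  move=> c /us /cantor_f2_in; congr (C _).
  by rewrite E /cantor_f2; field; exact: expf_neq0.
Qed.

End CantorGeometry.

(** * Nearly linear functions on products of triadic intervals *)

Section NearlyLinear.
Context {R : realType}.
Implicit Types (g : R -> R -> R) (a b e u v s x y : R).
Local Notation C := (cantor_set R).

(** Both ends of the increment vary over the square, so every subsquare inherits the property with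
    the same [a], [b] and [e]; this is what allows the subdivision to be iterated. *)
Definition nearly_linear g a b e u v s := forall x y x' y',
  u <= x <= u + s -> v <= y <= v + s -> u <= x' <= u + s -> v <= y' <= v + s ->
  `|g x' y' - g x y - (a * (x' - x) + b * (y' - y))|
    <= e * (`|x' - x| + `|y' - y|).

Lemma nearly_linear_sub g a b e u v s u' v' s' :
  u <= u' -> u' + s' <= u + s -> v <= v' -> v' + s' <= v + s ->
  nearly_linear g a b e u v s -> nearly_linear g a b e u' v' s'.
Proof. by move=> ? ? ? ? gl x y x' y' *; apply: gl; lra. Qed.

(** Positions are counted in units of [d], a third of the side. The bounds [h] and [k] stand in for
    the absolute displacements, so numerical positions leave only linear arithmetic. *)
Lemma nearly_linear_lb g a b e u v s d i j i' j' h k :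
  0 <= e -> 0 <= d -> s = 3 * d -> nearly_linear g a b e u v s ->
  0 <= i <= 3 -> 0 <= j <= 3 -> 0 <= i' <= 3 -> 0 <= j' <= 3 ->
  - h <= i' - i <= h -> - k <= j' - j <= k ->
  (a * (i' - i) + b * (j' - j) - e * (h + k)) * d <=
    g (u + i' * d) (v + j' * d) - g (u + i * d) (v + j * d).
Proof.
move=> e0 d0 sE gl i3 j3 i'3 j'3 ih jk.
have I r w : 0 <= r <= 3 -> w <= w + r * d <= w + s.
  by move=> /andP[? ?]; rewrite sE lerDl lerD2l mulr_ge0//= ler_wpM2r.
have := gl _ _ _ _ (I _ u i3) (I _ v j3) (I _ u i'3) (I _ v j'3).
rewrite ler_norml => /andP[+ _].
have k1 (w p q : R) : w + p * d - (w + q * d) = (p - q) * d by ring.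
rewrite !k1 !normrM (ger0_norm d0) -mulrDl.
have hi : `|i' - i| + `|j' - j| <= h + k by rewrite lerD// ler_norml.
have := ler_wpM2r d0 (ler_wpM2l e0 hi).
by clear; lra.
Qed.

(* For [g] linear these overlaps amount to [b <= a <= 3 * b]; the bounds on [e]
   absorb the nonlinearity. *)
Lemma nearly_linear_overlap g a b e u v s d :
  0 <= e -> 2 * e <= a - b -> 4 * e <= 3 * b - a -> 0 <= d -> s = 3 * d ->
  nearly_linear g a b e u v s ->
  [/\ g (u + 0 * d) (v + 2 * d) <= g (u + 1 * d) (v + 1 * d),
      g (u + 2 * d) (v + 0 * d) <= g (u + 1 * d) (v + 3 * d) &
      g (u + 2 * d) (v + 2 * d) <= g (u + 3 * d) (v + 1 * d)].
Proof.
move=> e0 eab e3b d0 sE gl.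
have lb i j i' j' h k := @nearly_linear_lb g a b e u v s d i j i' j' h k e0 d0 sE gl.
have es : 2 * e * d <= (a - b) * d by rewrite ler_wpM2r.
have es' : 4 * e * d <= (3 * b - a) * d by rewrite ler_wpM2r.
have r0 : 0 <= (0 : R) <= 3 by clear; lra.
have r1 : 0 <= (1 : R) <= 3 by clear; lra.
have r2 : 0 <= (2 : R) <= 3 by clear; lra.
have r3 : 0 <= (3 : R) <= 3 by clear; lra.
(* The displacements are (1, -1), (-1, 3) and (1, -1), with lower bounds [a - b - 2 * e],
   [3 * b - a - 4 * e] and [a - b - 2 * e], each times [d]. *)
have l1 := lb 0 2 1 1 1 1 r0 r2 r1 r1 ltac:(clear; lra) ltac:(clear; lra).
have l2 := lb 2 0 1 3 1 3 r2 r0 r1 r3 ltac:(clear; lra) ltac:(clear; lra).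
have l3 := lb 2 2 3 1 1 1 r2 r2 r3 r1 ltac:(clear; lra) ltac:(clear; lra).
move: es es' l1 l2 l3; clear => es es' l1 l2 l3.
by split; rewrite -subr_ge0; [apply: le_trans l1|apply: le_trans l2|apply: le_trans l3]; lra.
Qed.

Lemma nearly_linear_lip g a b e u v s x y x' y' :
  `|a| + e <= 2 * a -> `|b| + e <= 2 * a -> nearly_linear g a b e u v s ->
  u <= x <= u + s -> v <= y <= v + s -> u <= x' <= u + s -> v <= y' <= v + s ->
  `|g x' y' - g x y| <= 2 * a * (`|x' - x| + `|y' - y|).
Proof.
move=> ea eb gl xu yv x'u y'v.
have L := gl _ _ _ _ xu yv x'u y'v.
have := ler_normD (g x' y' - g x y - (a * (x' - x) + b * (y' - y)))
  (a * (x' - x) + b * (y' - y)).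
rewrite subrK.
have := ler_normD (a * (x' - x)) (b * (y' - y)); rewrite !normrM.
have := ler_wpM2r (normr_ge0 (x' - x)) ea.
have := ler_wpM2r (normr_ge0 (y' - y)) eb.
move: L; lra.
Qed.

Lemma nearly_linear_approx g a b e t n u v s :
  0 <= e -> 2 * e <= a - b -> 4 * e <= 3 * b - a -> 0 <= s ->
  cantor_copy u s -> cantor_copy v s -> nearly_linear g a b e u v s ->
  g u v <= t <= g (u + s) (v + s) ->
  exists x y, [/\ C x, C y, u <= x <= u + s, v <= y <= v + s &
    `|g x y - t| <= 8 * a * s / 3 ^+ n].
Proof.
move=> e0 eab e3b; elim: n u v s => [|n IH] u v s s0 cu cv gl tb.
  (* At depth 0 any point of the copy will do: by the Lipschitz bound, its value and [t] both lie
     within [4 * a * s] of [g u v], whence the factor 8. *)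
  have [[c Cc] _ _] : cantor_eq C by exact/cantor_setP.
  have c01 : 0 <= c <= 1 by have := cantor_set01 Cc; rewrite /= in_itv.
  have sc : 0 <= s * c <= s by rewrite mulr_ge0 ?ler_piMr//; case/andP: c01.
  exists (u + s * c), (v + s * c); split; [exact: cu|exact: cv|lra|lra|].
  have a0 : 0 <= a by lra. have b0 : 0 <= b by lra.
  have L x y x' y' := @nearly_linear_lip g a b e u v s x y x' y'.
  rewrite !ger0_norm// in L.
  have ea : a + e <= 2 * a by lra. have eb : b + e <= 2 * a by lra.
  have uu : u <= u <= u + s by lra. have vv : v <= v <= v + s by lra.
  have us : u <= u + s <= u + s by lra. have vs : v <= v + s <= v + s by lra.
  have uc : u <= u + s * c <= u + s by lra.
  have vc : v <= v + s * c <= v + s by lra.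
  have := L _ _ _ _ ea eb gl uu vv us vs.
  have := L _ _ _ _ ea eb gl uu vv uc vc.
  have k (w r : R) : w + r - w = r by ring.
  rewrite !k (ger0_norm s0) (@ger0_norm _ (s * c)); last by case/andP: sc.
  rewrite expr0 divr1 !ler_norml => /andP[l1 l2] /andP[l3 l4].
  have asc : a * (s * c) <= a * s by rewrite ler_wpM2l//; lra.
  by apply/andP; split; lra.
pose d := s / 3.
have d0 : 0 <= d by exact: divr_ge0.
have sE : s = 3 * d by rewrite /d; field.
have E : 8 * a * s / 3 ^+ n.+1 = 8 * a * d / 3 ^+ n.
  by rewrite exprS /d; field; exact: expf_neq0.
have [le1 le2 le3] := nearly_linear_overlap e0 eab e3b d0 sE gl.
have copy0 w : cantor_copy w s -> cantor_copy (w + 0 * d) d.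
  by rewrite mul0r addr0; exact: cantor_copy1.
have copy2 w : cantor_copy w s -> cantor_copy (w + 2 * d) d.
  by rewrite /d mulrA; exact: cantor_copy2.
have top r w : w + r * d + d = w + (r + 1) * d by ring.
have inside r w : 0 <= r <= 2 -> w <= w + r * d /\ w + r * d + d <= w + s.
  move=> /andP[r0 r2]; rewrite top sE lerDl lerD2l mulr_ge0//; split=> //.
  by rewrite ler_wpM2r//; clear -r2; lra.
have step i j : 0 <= i <= 2 -> 0 <= j <= 2 ->
    cantor_copy (u + i * d) d -> cantor_copy (v + j * d) d ->
    g (u + i * d) (v + j * d) <= t <= g (u + (i + 1) * d) (v + (j + 1) * d) ->
    exists x y, [/\ C x, C y, u <= x <= u + s, v <= y <= v + s &
      `|g x y - t| <= 8 * a * s / 3 ^+ n.+1].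
  move=> /(inside _ u)[ui iu] /(inside _ v)[vj jv] ci cj; rewrite -!top => tb'.
  have [x [y [Cx Cy /andP[ux xu] /andP[vy yv] xyt]]] :=
    IH _ _ _ d0 ci cj (nearly_linear_sub ui iu vj jv gl) tb'.
  exists x, y; split => //; last by rewrite E.
    by rewrite (le_trans ui)//= (le_trans xu).
  by rewrite (le_trans vj)//= (le_trans yv).
have r0 : 0 <= (0 : R) <= 2 by clear; lra.
have r2 : 0 <= (2 : R) <= 2 by clear; lra.
have k1 : 0 + 1 = 1 :> R by clear; lra.
have k3 : 2 + 1 = 3 :> R by clear; lra.
have wE w : w + 0 * d = w by rewrite mul0r addr0.
case/andP: tb => tlo thi.
(* The subsquares are tried in the order (0, 0), (0, 2), (2, 0), (2, 2). If [t] exceeds the upper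
   corner value of one, the overlap puts it above the lower corner value of the next. *)
have [t1|/ltW t1] := leP t (g (u + 1 * d) (v + 1 * d)).
  by apply: (step 0 0) => //; [exact: copy0|exact: copy0|rewrite !k1 !wE tlo].
have [t2|/ltW t2] := leP t (g (u + 1 * d) (v + 3 * d)).
  apply: (step 0 2) => //; [exact: copy0|exact: copy2|].
  by rewrite k1 k3 t2 (le_trans le1).
have [t3|/ltW t3] := leP t (g (u + 3 * d) (v + 1 * d)).
  apply: (step 2 0) => //; [exact: copy2|exact: copy0|].
  by rewrite k1 k3 t3 (le_trans le2).
apply: (step 2 2) => //; [exact: copy2|exact: copy2|].
by rewrite k3 -sE thi (le_trans le3).
Qed.


(** The image of the compact set [K] is closed, and the approximations put [t] in its closure. *)
Lemma nearly_linear_surj g a b e t u v s :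
  0 <= e -> 2 * e <= a - b -> 4 * e <= 3 * b - a -> 0 <= s ->
  cantor_copy u s -> cantor_copy v s -> nearly_linear g a b e u v s ->
  g u v <= t <= g (u + s) (v + s) ->
  exists x y, [/\ C x, C y, u <= x <= u + s, v <= y <= v + s & g x y = t].
Proof.
move=> e0 eab e3b s0 cu cv gl tb.
pose K := (C `&` `[u, u + s]) `*` (C `&` `[v, v + s]).
pose G (p : R * R) := g p.1 p.2.
have cI w : compact (C `&` `[w, w + s]).
  by apply: compact_closedI; [exact: cantor_set_compact|exact: interval_closed].
have Kcpt : compact K by exact: compact_setX.
have ea : `|a| + e <= 2 * a by rewrite ger0_norm; lra.
have eb : `|b| + e <= 2 * a by rewrite ger0_norm; lra.
have a0 : 0 <= a by lra.
have GK : {within K, continuous G}.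
  apply/subspace_continuousP => -[x y] [[Cx /= xu] [Cy /= yv]].
  apply/cvgrPdist_lt => r r0.
  (* The Lipschitz bound allows a variation of at most [4 * a] times the radius; adding 1 keeps the
     divisor positive when [a = 0]. *)
  have k0 : 0 < 4 * a + 1 by lra.
  have rk : 0 < r / (4 * a + 1) by rewrite divr_gt0.
  apply/nbhs_ballP; exists (r / (4 * a + 1)) => //= -[x' y'] [/= bx by'].
  move=> [[_ /= x'u] [_ /= y'v]].
  move: xu yv x'u y'v; rewrite !in_itv/= => xu yv x'u y'v.
  have L := nearly_linear_lip ea eb gl xu yv x'u y'v.
  move: bx by'; rewrite -!ball_normE/= (distrC x) (distrC y) => bx by'.
  change (`|g x y - g x' y'| < r); rewrite distrC.
  apply: le_lt_trans L _.
  have := ltW bx; have := ltW by'; rewrite !ler_pdivlMr//.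
  move: (bx); rewrite ltr_pdivlMr//.
  have := mulr_ge0 a0 (normr_ge0 (x' - x)).
  have := mulr_ge0 a0 (normr_ge0 (y' - y)).
  have := normr_ge0 (x' - x); have := normr_ge0 (y' - y).
  by clear -R; move=> *; lra.
have : (G @` K) t.
  have clG : closed (G @` K).
    by apply: compact_closed; [exact: Rhausdorff|exact: continuous_compact].
  rewrite (closure_id (G @` K)).1// => N /nbhs_ballP[r /= r0 rN].
  have [n nr] := div_pow3_lt (8 * a * s) r0.
  have [x [y [Cx Cy xu yv xyt]]] := nearly_linear_approx n e0 eab e3b s0 cu cv gl tb.
  exists (g x y); split.
    by exists (x, y) => //; split; split; rewrite //= in_itv.
  apply: rN; rewrite -ball_normE/= distrC.
  exact: le_lt_trans xyt nr.
move=> [[x y] [[Cx /= xu] [Cy /= yv]] gt].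
by exists x, y; move: xu yv; rewrite !in_itv.
Qed.

(** * Strict differentiability and reduction by symmetry *)

Definition strictly_differentiable g (x0 y0 a b : R) := forall e, 0 < e ->
  exists2 d, 0 < d & forall x y x' y',
    `|x - x0| < d -> `|y - y0| < d -> `|x' - x0| < d -> `|y' - y0| < d ->
    `|g x' y' - g x y - (a * (x' - x) + b * (y' - y))|
      <= e * (`|x' - x| + `|y' - y|).

(** Asking for the values arbitrarily close to the base point makes it possible to stay inside an
    open set later on. *)
Definition fills_interval g (x0 y0 : R) := forall d, 0 < d ->
  exists lo hi, lo < hi /\ forall t, lo <= t <= hi ->
    exists x y, [/\ C x, C y, `|x - x0| < d, `|y - y0| < d & g x y = t].

(** Strict differentiability controls increments between any two points near the base point, so [g]
    is nearly linear on a small triadic square wherever in it the base point lies. *)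
Lemma fills_interval_pos g x0 y0 a b : C x0 -> C y0 -> b < a < 3 * b ->
  strictly_differentiable g x0 y0 a b -> fills_interval g x0 y0.
Proof.
move=> Cx0 Cy0 /andP[ba ab] gd d d0.
(* The largest error that the overlap conditions tolerate, positive because [b < a < 3 * b]. *)
pose e := Num.min ((a - b) / 2) ((3 * b - a) / 4).
have e0 : 0 < e by rewrite lt_min !divr_gt0 ?subr_gt0.
have eab : 2 * e <= a - b by rewrite mulrC -ler_pdivlMr// ge_min lexx.
have e3b : 4 * e <= 3 * b - a by rewrite mulrC -ler_pdivlMr// ge_min lexx orbT.
have [d' d'0 gl] := gd e e0.
have m0 : 0 < Num.min d d' by rewrite lt_min d0.
have [n] := div_pow3_lt 1 m0; rewrite mul1r => nd.
move: nd; rewrite lt_min => /andP[nd nd'].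
have [u [cu ux]] := cantor_copy_around n Cx0.
have [v [cv vy]] := cantor_copy_around n Cy0.
set s := 3 ^- n in nd nd' cu cv ux vy.
have s0 : 0 < s by rewrite invr_gt0 exprn_gt0.
have near w z r z0 : s < r -> w <= z0 <= w + s -> w <= z <= w + s -> `|z - z0| < r.
  by clear -R; move=> *; rewrite ltr_norml; apply/andP; split; lra.
have gL : nearly_linear g a b e u v s.
  by move=> x y x' y' xu yv x'u y'v; apply: gl;
    [exact: near ux xu|exact: near vy yv|exact: near ux x'u|exact: near vy y'v].
exists (g u v), (g (u + s) (v + s)); split; last first.
  move=> t /(nearly_linear_surj (ltW e0) eab e3b (ltW s0) cu cv gL).
  move=> [x [y [Cx Cy xu yv xyt]]]; exists x, y; split => //.
    exact: near ux xu.
  exact: near vy yv.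
have wl w : w <= w <= w + s by rewrite lexx lerDl ltW.
have wr w : w <= w + s <= w + s by rewrite lexx andbT lerDl ltW.
have := gL _ _ _ _ (wl u) (wl v) (wr u) (wr v).
have k (w : R) : w + s - w = s by ring.
rewrite !k (gtr0_norm s0) ler_norml => /andP[+ _].
(* This bounds from below the growth of [g] along the diagonal; since [2 * e <= a - b], the factor
   is at least [2 * b], which is positive. *)
have : 0 < (a + b - 2 * e) * s by rewrite mulr_gt0//; lra.
by clear -R; lra.
Qed.

Lemma fills_interval_reflect1 g x0 y0 :
  fills_interval (fun x y => g (1 - x) y) (1 - x0) y0 -> fills_interval g x0 y0.
Proof.
move=> fg d /fg[lo [hi [lohi h]]]; exists lo, hi; split=> // t /h[x [y [Cx Cy xd yd <-]]].
exists (1 - x), y; split=> //; first exact: cantor_set_reflect.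
by rewrite -normrN; move: xd; congr (`|_| < _); ring.
Qed.

Lemma fills_interval_swap g x0 y0 :
  fills_interval (fun x y => g y x) y0 x0 -> fills_interval g x0 y0.
Proof.
move=> fg d /fg[lo [hi [lohi h]]]; exists lo, hi; split=> // t /h[x [y [Cx Cy xd yd <-]]].
by exists y, x.
Qed.

Lemma strictly_differentiable_reflect1 g x0 y0 a b :
  strictly_differentiable g x0 y0 a b ->
  strictly_differentiable (fun x y => g (1 - x) y) (1 - x0) y0 (- a) b.
Proof.
move=> gd e /gd[d d0 h]; exists d => // x y x' y'.
have k (p q : R) : p - (1 - q) = - (1 - p - q) by ring.
rewrite !k !normrN => xd yd x'd y'd.
have := h _ _ _ _ xd yd x'd y'd.
have -> : 1 - x' - (1 - x) = - (x' - x) by ring.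
by rewrite normrN mulrN mulNr.
Qed.

Lemma strictly_differentiable_swap g x0 y0 a b :
  strictly_differentiable g x0 y0 a b ->
  strictly_differentiable (fun x y => g y x) y0 x0 b a.
Proof.
move=> gd e /gd[d d0 h]; exists d => // x y x' y' xd yd x'd y'd.
rewrite [b * _ + _]addrC [`|x' - x| + _]addrC; exact: h.
Qed.

(** Reflections make the gradient positive one coordinate at a time: [step1] settles the sign of
    [a], the rest that of [b]. *)
Lemma fills_interval_gt g x0 y0 a b : C x0 -> C y0 -> `|b| < `|a| < 3 * `|b| ->
  strictly_differentiable g x0 y0 a b -> fills_interval g x0 y0.
Proof.
have step1 h x1 y1 a' b' : C x1 -> C y1 -> b' < `|a'| < 3 * b' ->
    strictly_differentiable h x1 y1 a' b' -> fills_interval h x1 y1.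
  move=> Cx Cy; case: (ger0P a') => _ ab hd; first exact: fills_interval_pos hd.
  apply: fills_interval_reflect1.
  apply: fills_interval_pos (strictly_differentiable_reflect1 hd) => //.
  exact: cantor_set_reflect.
move=> Cx Cy; case: (ger0P b) => _ ab gd; first exact: step1 gd.
(* Reflection in the second variable is reflection in the first, conjugated by the swap. *)
apply/fills_interval_swap/fills_interval_reflect1/fills_interval_swap.
apply: step1 (strictly_differentiable_swap (strictly_differentiable_reflect1
  (strictly_differentiable_swap gd))) => //.
exact: cantor_set_reflect.
Qed.

Lemma strictly_differentiable_fills_interval g x0 y0 a b : C x0 -> C y0 ->
  `|b| < `|a| < 3 * `|b| \/ `|a| < `|b| < 3 * `|a| ->
  strictly_differentiable g x0 y0 a b -> fills_interval g x0 y0.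
Proof.
move=> Cx Cy [ab|ab] gd; first exact: fills_interval_gt gd.
apply: fills_interval_swap.
exact: fills_interval_gt (strictly_differentiable_swap gd).
Qed.

End NearlyLinear.

(** * From continuous partial derivatives to strict differentiability *)

Section ContinuousPartials.
Context {R : realType}.
Implicit Types (f : R * R -> R) (e : R).

(** Passes from directional derivatives to derivatives of one-variable slices, where the mean value
    theorem applies. *)
Lemma is_derive_x f x y : derivable_x f (x, y) ->
  is_derive x 1 (fun t => f (t, y)) (partial_x f (x, y)).
Proof.
have E : (fun h : R => h^-1 *: (((fun t => f (t, y)) \o shift x) (h *: 1) - f (x, y)))
   = (fun h : R => h^-1 *: ((f \o shift (x, y)) (h *: (1, 0)) - f (x, y))).
  apply/funext => h /=; congr (_ *: (f _ - _)).
  by congr pair; rewrite /= ?scaler0 ?add0r.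
by move=> fd; split; [rewrite /derivable E|rewrite /derive E].
Qed.

Lemma is_derive_y f x y : derivable_y f (x, y) ->
  is_derive y 1 (fun t => f (x, t)) (partial_y f (x, y)).
Proof.
have E : (fun h : R => h^-1 *: (((fun t => f (x, t)) \o shift y) (h *: 1) - f (x, y)))
   = (fun h : R => h^-1 *: ((f \o shift (x, y)) (h *: (0, 1)) - f (x, y))).
  apply/funext => h /=; congr (_ *: (f _ - _)).
  by congr pair; rewrite /= ?scaler0 ?add0r.
by move=> fd; split; [rewrite /derivable E|rewrite /derive E].
Qed.

(** The increment of [h] is [dh z * (x' - x)] for some [z] between the two points, and [dh z]
    differs from [c] by at most [e]. *)
Lemma mean_value_close (h dh : R -> R) (c r x0 e x x' : R) :
  (forall z, `|z - x0| < r -> is_derive z 1 h (dh z)) ->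
  (forall z, `|z - x0| < r -> `|dh z - c| <= e) ->
  `|x - x0| < r -> `|x' - x0| < r ->
  `|h x' - h x - c * (x' - x)| <= e * `|x' - x|.
Proof.
move=> hd dhc; wlog xx' : x x' / x <= x'.
  move=> W xr x'r; have [xx'|/ltW x'x] := leP x x'; first exact: W.
  have := W _ _ x'x x'r xr; rewrite (distrC x).
  have -> : h x - h x' - c * (x - x') = - (h x' - h x - c * (x' - x)) by ring.
  by rewrite normrN.
move=> xr x'r.
have inr z : z \in `[x, x'] -> `|z - x0| < r.
  rewrite in_itv/=; move: xr x'r; rewrite !ltr_norml.
  by clear -R; move=> /andP[? ?] /andP[? ?] /andP[? ?]; apply/andP; split; lra.
have [||z zi ->] := @MVT_segment R h dh x x' xx'.
- by move=> z /subset_itv_oo_cc/inr; exact: hd.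
- apply: derivable_within_continuous => z /inr zr.
  by have := hd z zr; case.
by rewrite -mulrBl normrM ler_wpM2r// dhc// inr.
Qed.

(** As [U] is open, continuity within it is ordinary continuity at its points; balls of the product
    are squares, hence the separate bounds on the coordinates. *)
Lemma continuous_within_open_dist (U : set (R * R)) f x0 y0 e :
  open U -> U (x0, y0) -> {within U, continuous f} -> 0 < e ->
  exists2 d, 0 < d & forall x y, `|x - x0| < d -> `|y - y0| < d ->
    U (x, y) /\ `|f (x, y) - f (x0, y0)| < e.
Proof.
move=> oU Up /subspace_continuousP/(_ _ Up) cf e0.
have nU : nbhs (x0, y0) U by exact: open_nbhs_nbhs.
have : nbhs (x0, y0) [set p | U p /\ `|f (x0, y0) - f p| < e].
  move/cvgrPdist_lt: cf => /(_ _ e0) cf.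
  by apply: filterS2 nU cf => p Up' /(_ Up').
move/(nbhs_ballP (x0, y0)) => [d /= d0 dP].
exists d => // x y xd yd; have [] := dP (x, y).
  by split; rewrite -ball_normE/= distrC.
by move=> Uxy; rewrite distrC.
Qed.

(** The increment is split at the corner [(x, y')]. Both legs stay in a square where the partial
    derivatives vary by at most [e] from their values at the centre, so the mean value estimate
    applies to each. *)
Lemma C1_strictly_differentiable (U : set (R * R)) f x0 y0 : open U -> U (x0, y0) ->
  (forall p, U p -> derivable_x f p) -> (forall p, U p -> derivable_y f p) ->
  {within U, continuous (partial_x f)} -> {within U, continuous (partial_y f)} ->
  strictly_differentiable (fun x y => f (x, y)) x0 y0
    (partial_x f (x0, y0)) (partial_y f (x0, y0)).
Proof.
move=> oU Up fdx fdy.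
move=> cx cy e e0.
have [dx dx0 xP] := continuous_within_open_dist oU Up cx e0.
have [dy dy0 yP] := continuous_within_open_dist oU Up cy e0.
pose d := Num.min dx dy.
have d0 : 0 < d by rewrite lt_min dx0.
have dP x y : `|x - x0| < d -> `|y - y0| < d -> [/\ U (x, y),
    `|partial_x f (x, y) - partial_x f (x0, y0)| <= e &
    `|partial_y f (x, y) - partial_y f (x0, y0)| <= e].
  rewrite !lt_min => /andP[xdx xdy] /andP[ydx ydy].
  by have [? /ltW] := xP _ _ xdx ydx; have [_ /ltW] := yP _ _ xdy ydy.
exists d => // x y x' y' xd yd x'd y'd.
have hx : `|f (x', y') - f (x, y') - partial_x f (x0, y0) * (x' - x)| <= e * `|x' - x|.
  apply: (@mean_value_close (fun t => f (t, y')) (fun t => partial_x f (t, y')) _ d x0) => //.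
    by move=> z zd; have [Uz _ _] := dP _ _ zd y'd; exact/is_derive_x/fdx.
  by move=> z zd; have [] := dP _ _ zd y'd.
have hy : `|f (x, y') - f (x, y) - partial_y f (x0, y0) * (y' - y)| <= e * `|y' - y|.
  apply: (@mean_value_close (fun t => f (x, t)) (fun t => partial_y f (x, t)) _ d y0) => //.
    by move=> z zd; have [Uz _ _] := dP _ _ xd zd; exact/is_derive_y/fdy.
  by move=> z zd; have [] := dP _ _ xd zd.
have tri (p q r1 r2 : R) : `|p| <= r1 -> `|q| <= r2 -> `|p + q| <= r1 + r2.
  by move=> pr qr; apply: le_trans (ler_normD _ _) _; exact: lerD.
rewrite mulrDr; move: (tri _ _ _ _ hx hy); congr (`|_| <= _); ring.
Qed.

Lemma norm_quotient_bounds (a b : R) : b != 0 -> 1 < `|a / b| < 3 ->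
  `|b| < `|a| < 3 * `|b|.
Proof.
by move=> b0; rewrite normf_div ltr_pdivlMr ?ltr_pdivrMr ?normr_gt0// mul1r.
Qed.

End ContinuousPartials.

(** * Non-empty interior of the image *)

Unset Implicit Arguments.
Theorem theorem1 (R : realType) (U : set (R * R)) (f : R * R -> R)
    (openU : open U)
    (f_cont : {within U, continuous f})
    (f_derx : forall p, U p -> derivable_x f p)
    (f_dery : forall p, U p -> derivable_y f p)
    (fx_cont : {within U, continuous (partial_x f)})
    (fy_cont : {within U, continuous (partial_y f)})
    (p0 : R * R)
    (p0_in : ((cantor_set R `*` cantor_set R) `&` U) p0)
    (quot : (partial_y f p0 != 0 /\
               1 < `|partial_x f p0 / partial_y f p0| < 3) \/
            (partial_x f p0 != 0 /\
               1 < `|partial_y f p0 / partial_x f p0| < 3)) :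
  interior (f @` ((cantor_set R `*` cantor_set R) `&` U)) !=set0.

Proof.
case: p0 p0_in quot => x0 y0 [[/= Cx0 Cy0] Ux0] quot.
have fd := C1_strictly_differentiable openU Ux0 f_derx f_dery fx_cont fy_cont.
have ab : `|partial_y f (x0, y0)| < `|partial_x f (x0, y0)|
            < 3 * `|partial_y f (x0, y0)| \/
          `|partial_x f (x0, y0)| < `|partial_y f (x0, y0)|
            < 3 * `|partial_x f (x0, y0)|.
  by case: quot => -[? ?]; [left|right]; exact: norm_quotient_bounds.
(* This provides a square around the base point inside [U]; the tolerance 1 is arbitrary. *)
have [d d0 dU] := continuous_within_open_dist openU Ux0 f_cont ltr01.
have [lo [hi [lohi fill]]] := strictly_differentiable_fills_interval Cx0 Cy0 ab fd d0.
exists ((lo + hi) / 2); apply: (@filterS _ _ _ `]lo, hi[%classic).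
  move=> t /=; rewrite in_itv/= => /andP[/ltW lot /ltW thi].
  have [|x [y [Cx Cy xd yd <-]]] := fill t; first by rewrite lot.
  by exists (x, y) => //; split => //; have [] := dU _ _ xd yd.
apply: open_nbhs_nbhs; split; first exact: interval_open.
by rewrite /= in_itv/= !midf_lt.
Qed.
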